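(* Let $h(t)=\sum_{m=0}^{N}b_mt^m$ be a monic polynomial of degree $N$ with real coefficients. Let $(f,g)_0=\int_I f g\,d\mu_0$ be a positive definite bilinear form on the space $\mathbb{P}$ of real polynomials, and let $[\cdot,\cdot]_h$ be a positive definite symmetric bilinear form on $\mathbb{P}$ with $[hf,g]_h=[f,hg]_h=(f,g)_0$ for all $f,g\in\mathbb{P}$. Let $\{P_n\}_{n\ge0}$ and $\{P_n^*\}_{n\ge0}$ be the sequences of monic orthogonal polynomials with respect to $(\cdot,\cdot)_0$ and $[\cdot,\cdot]_h$, respectively, and let $J_{mon}$, $J_{mon}^*$, $L_{mon}$, $U_{mon}$ be the semi-infinite matrices associated with them as defined in the context. Then $$h(J_{mon})=\sum_{m=0}^{N}b_mJ_{mon}^m=U_{mon}L_{mon}$$ and $$J_{mon}^*=L_{mon}U_{mon}.$$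
   Context: A symmetric bilinear form $B$ on $\mathbb{P}$ is positive definite if all leading principal minors of its Gram matrix $(B(t^i,t^j))_{i,j\ge0}$ are positive. Write $P=(P_0,P_1,\dots)^T$, $P^*=(P_0^*,P_1^*,\dots)^T$, and $P_j=0$ for $j<0$. $J_{mon}$ is the monic Jacobi matrix: $tP_n=P_{n+1}+D_nP_n+C_nP_{n-1}$, i.e. $tP=J_{mon}P$ with $J_{mon}$ tridiagonal (diagonal $D_n$, superdiagonal $1$, subdiagonal $C_n$). $J_{mon}^*$ is the $(2N+1)$-band matrix of the recurrence $h(t)P_n^*(t)=\sum_{k=\max(0,n-N)}^{n+N}c_k^{[n]}P_k^*(t)$, $c_{n+N}^{[n]}=1$, with entry $c_k^{[n]}$ in row $n$, column $k$, so that $hP^*=J_{mon}^*P^*$. $L_{mon}$: one has $P_n^*=P_n+A_{n-1}^{[n]}P_{n-1}+\dots+A_{n-N}^{[n]}P_{n-N}$; $L_{mon}$ is the unit lower triangular band matrix with entry $A_k^{[n]}$ in row $n$, column $k$ for $\max(0,n-N)\le k<n$, so that $P^*=L_{mon}P$. $U_{mon}$: one has $hP_n=\sum_{i=n}^{n+N}B_i^{[n+N]}P_i^*$ with $B_{n+N}^{[n+N]}=1$ and $B_n^{[n+N]}\ne0$; $U_{mon}$ is the upper triangular band matrix with entry $B_i^{[n+N]}$ in row $n$, column $i$ for $n\le i\le n+N$ (zero elsewhere), so that $hP=U_{mon}P^*$. *)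

(* Defs.v *)
From HB Require Import structures.
From mathcomp Require Import all_boot all_order all_algebra.
From mathcomp Require Import all_classical all_reals all_analysis.

Set Implicit Arguments.
Unset Strict Implicit.
Unset Printing Implicit Defensive.

Import Order.TTheory GRing.Theory Num.Theory.
Import numFieldNormedType.Exports.

Local Open Scope ring_scope.

Definition integral_form (R : realType)
    (mu : {measure set (measurableTypeR R) -> \bar R}) (I : interval R)
    (f g : {poly R}) : R :=
  \int[mu]_(x in [set` I]) (f.[x] * g.[x]).

Definition positive_definite (R : realType)
    (B : {poly R} -> {poly R} -> R) : Prop :=
  forall n : nat, 0 < \det (\matrix_(i < n.+1, j < n.+1) B 'X^i 'X^j).

Definition monic_orthogonal (R : realType)
    (B : {poly R} -> {poly R} -> R) (P : nat -> {poly R}) : Prop :=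
  (forall n, P n \is monic /\ size (P n) = n.+1) /\
  (forall m n, m != n -> B (P m) (P n) = 0).

(* P_(n-1), with the convention P_(-1) = 0. *)
Definition prev_poly (R : realType) (P : nat -> {poly R}) (n : nat) : {poly R} :=
  if n is m.+1 then P m else 0.

(* Truncated subtraction makes (n - N)%N equal to max(0, n-N) in the ranges
   below. The argument order follows the superscript: c n k, A n k and B n k
   stand for c_k^{[n]}, A_k^{[n]} and B_k^{[n]}. *)

Definition jacobi_coefs (R : realType) (P : nat -> {poly R})
    (D C : nat -> R) : Prop :=
  forall n, 'X * P n = P n.+1 + D n *: P n + C n *: prev_poly P n.

Definition recurrence_coefs (R : realType) (N : nat) (h : {poly R})
    (Ps : nat -> {poly R}) (c : nat -> nat -> R) : Prop :=
  forall n, h * Ps n = \sum_(n - N <= k < (n + N).+1) c n k *: Ps k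
            /\ c n (n + N)%N = 1.

Definition lower_coefs (R : realType) (N : nat) (P Ps : nat -> {poly R})
    (A : nat -> nat -> R) : Prop :=
  forall n, Ps n = P n + \sum_(n - N <= k < n) A n k *: P k.

Definition upper_coefs (R : realType) (N : nat) (h : {poly R})
    (P Ps : nat -> {poly R}) (B : nat -> nat -> R) : Prop :=
  forall n, [/\ h * P n = \sum_(n <= i < (n + N).+1) B (n + N)%N i *: Ps i,
                B (n + N)%N (n + N)%N = 1
              & B (n + N)%N n != 0].

(* Semi-infinite matrices: entry in row i, column j is M i j. *)
Definition infmx (R : realType) := nat -> nat -> R.

Definition J_mon (R : realType) (D C : nat -> R) : infmx R :=
  fun i j => if j == i.+1 then 1
             else if j == i then D i
             else if i == j.+1 then C i
             else 0.

Definition Js_mon (R : realType) (N : nat) (c : nat -> nat -> R) : infmx R :=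
  fun n k => if (n - N <= k <= n + N)%N then c n k else 0.

Definition L_mon (R : realType) (N : nat) (A : nat -> nat -> R) : infmx R :=
  fun n k => if k == n then 1
             else if (n - N <= k < n)%N then A n k
             else 0.

Definition U_mon (R : realType) (N : nat) (B : nat -> nat -> R) : infmx R :=
  fun n i => if (n <= i <= n + N)%N then B (n + N)%N i else 0.

Definition infmx1 (R : realType) : infmx R := fun i j => (i == j)%:R.

(* The sum over all k in nat is the sum of a finitely supported family; the
   support is finite for every entry when X is a band matrix. *)
Definition infmx_mul (R : realType) (X Y : infmx R) : infmx R :=
  fun i j => \sum_(k \in [set: nat]) X i k * Y k j.

Definition infmx_exp (R : realType) (X : infmx R) (m : nat) : infmx R :=
  iter m (infmx_mul X) (infmx1 R).

Definition infmx_horner (R : realType) (N : nat) (h : {poly R})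
    (X : infmx R) : infmx R :=
  fun i j => \sum_(m < N.+1) h`_m * infmx_exp X m i j.

(* Main.v *)
Require Import Defs.
From HB Require Import structures.
From mathcomp Require Import all_boot all_order all_algebra.
From mathcomp Require Import all_classical all_reals all_analysis.

Set Implicit Arguments.
Unset Strict Implicit.
Unset Printing Implicit Defensive.

Import Order.TTheory GRing.Theory Num.Theory.
Import numFieldNormedType.Exports.

Local Open Scope ring_scope.

(** Each of the matrices J, Js, L, U acts on sequences of polynomials, and the
    defining recurrences say how: J sends P to XP, Js sends Ps to h Ps,
    L sends P to Ps and U sends Ps to hP.  Multiplication by a fixed polynomial
    is linear, so it commutes with the action of a matrix; hence J^m sends P to
    X^m P, and h(J) sends P to hP ([act_horner]).  Composing actions
    ([act_mul]),
      h(J) P = hP = U Ps = (UL) P   and   Js Ps = h Ps = h (L P) = L (hP) = (LU) Ps.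
    The polynomials P_n, and likewise the Ps_n, have degree exactly n and so are
    linearly independent; two matrices with finite rows that act alike on them
    are therefore equal ([act_inj]).

    Associativity and linearity require the rows to be finite, with a uniform
    bound: every matrix here vanishes beyond some superdiagonal ([upper_band]). *)

Section InfiniteMatrices.

Variable R : realType.
Implicit Types (V : lmodType R) (X Y : infmx R) (q h : {poly R}).

Definition upper_band (d : nat) X : Prop :=
  forall i k, (i + d < k)%N -> X i k = 0.

(** Taking the values in any module makes the matrix product a special case: the
    columns of [infmx_mul X Y] are the action of [X] on the columns of [Y]. *)
Definition infmx_act V X (F : nat -> V) (i : nat) : V :=
  \sum_(k \in [set: nat]) X i k *: F k.

(** * Finite rows *)

Lemma infmx_actE V d X (F : nat -> V) i n :
  upper_band d X -> (i + d < n)%N ->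
  infmx_act X F i = \sum_(k < n) X i k *: F k.
Proof.
move=> bX ltn; rewrite /infmx_act (fsbig_ord _ _ (fun k => X i k *: F k)).
apply: esym; apply: fsbig_widen => // k [_ /= /negP].
by rewrite -leqNgt => lek; rewrite bX ?scale0r//; exact: leq_trans lek.
Qed.

Lemma infmx_mulE d X Y i j n :
  upper_band d X -> (i + d < n)%N ->
  infmx_mul X Y i j = \sum_(k < n) X i k * Y k j.
Proof. exact: (@infmx_actE R^o d X (fun k => Y k j)). Qed.

Lemma upper_bandW d e X : (d <= e)%N -> upper_band d X -> upper_band e X.
Proof.
by move=> de bX i k ltk; apply: bX; apply: leq_ltn_trans ltk; rewrite leq_add2l.
Qed.

Lemma upper_band1 : upper_band 0 (@infmx1 R).
Proof. by move=> i k; rewrite addn0 /infmx1 => /ltn_eqF ->. Qed.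

Lemma upper_band_mul d e X Y :
  upper_band d X -> upper_band e Y -> upper_band (d + e) (infmx_mul X Y).
Proof.
move=> bX bY i j ltj; rewrite (infmx_mulE Y j bX (ltnSn _)) big1// => k _.
rewrite bY ?mulr0//; apply: leq_ltn_trans ltj.
by rewrite addnA leq_add2r -ltnS.
Qed.

Lemma upper_band_exp X m : upper_band 1 X -> upper_band m (infmx_exp X m).
Proof.
move=> bX; elim: m => [|m IH]; first exact: upper_band1.
exact: (upper_band_mul bX IH).
Qed.

Lemma upper_band_horner N h X :
  upper_band 1 X -> upper_band N (infmx_horner N h X).
Proof.
move=> bX i k ltk; rewrite /infmx_horner big1// => m _.
have mN : (m <= N)%N by rewrite -ltnS.
by rewrite (upper_bandW mN (upper_band_exp bX)) ?mulr0.
Qed.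

(** * The action of a matrix on a sequence *)

Lemma act1 V (F : nat -> V) : infmx_act (@infmx1 R) F = F.
Proof.
apply/funext => i; rewrite (@infmx_actE _ 0 _ _ _ i.+1) ?addn0 //; last exact: upper_band1.
rewrite (bigD1 ord_max)//= /infmx1 eqxx scale1r big1 ?addr0// => k /negbTE nk.
by rewrite eq_sym (_ : (k == i :> nat) = false) ?scale0r//.
Qed.

(** Both sides are the double sum of [X i k * Y k l *: F l], summed in the two
    possible orders; the band hypotheses make it a finite one. *)
Lemma act_mul V d e X Y (F : nat -> V) :
  upper_band d X -> upper_band e Y ->
  infmx_act (infmx_mul X Y) F = infmx_act X (infmx_act Y F).
Proof.
move=> bX bY; apply/funext => i.
rewrite (infmx_actE F (upper_band_mul bX bY) (ltnSn _)) (infmx_actE _ bX (ltnSn _)).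
under eq_bigr => l _ do rewrite (infmx_mulE Y l bX (ltnSn _)) scaler_suml.
rewrite exchange_big; apply: eq_bigr => k _ /=.
rewrite (@infmx_actE _ e _ _ _ (i + (d + e)).+1)//.
  by rewrite scaler_sumr; apply: eq_bigr => l _; rewrite scalerA.
by rewrite addnA ltnS leq_add2r -ltnS.
Qed.

Lemma act_mulpoly d X q (F : nat -> {poly R}) :
  upper_band d X ->
  infmx_act X (fun k => q * F k) = fun i => q * infmx_act X F i.
Proof.
move=> bX; apply/funext => i; rewrite !(infmx_actE _ bX (ltnSn _)) mulr_sumr.
by apply: eq_bigr => k _; rewrite scalerAr.
Qed.

Lemma act_exp X q (F : nat -> {poly R}) m :
  upper_band 1 X -> infmx_act X F = (fun i => q * F i) ->
  infmx_act (infmx_exp X m) F = fun i => q ^+ m * F i.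
Proof.
move=> bX XF; elim: m => [|m IH].
  by rewrite act1; apply/funext => i; rewrite mul1r.
rewrite /infmx_exp iterS (act_mul _ bX (upper_band_exp bX)) IH.
rewrite (act_mulpoly _ _ bX) XF; apply/funext => i.
by rewrite mulrA -exprSr.
Qed.

Lemma act_horner N h X (F : nat -> {poly R}) :
  size h = N.+1 -> upper_band 1 X -> infmx_act X F = (fun i => 'X * F i) ->
  infmx_act (infmx_horner N h X) F = fun i => h * F i.
Proof.
move=> sh bX XF; apply/funext => i.
rewrite (infmx_actE _ (upper_band_horner h bX) (ltnSn _)).
under eq_bigr => k _ do rewrite scaler_suml.
rewrite exchange_big /= -[in RHS](coefK h) poly_def sh mulr_suml.
apply: eq_bigr => m _; rewrite -scalerAl.
under eq_bigr => k _ do rewrite -scalerA.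
rewrite -scaler_sumr -(congr1 (@^~ i) (act_exp m bX XF)).
by rewrite (infmx_actE _ (upper_band_exp bX) (n := (i + N).+1))// ltnS leq_add2l -ltnS.
Qed.

(** The coefficient of degree [n] in a combination of [F 0, .., F n] comes from
    [F n] alone, so a vanishing combination loses its last term, and then the
    one before. *)
Lemma simple_sequence_free (F : nat -> {poly R}) (a : nat -> R) n :
  (forall k, size (F k) = k.+1) ->
  \sum_(k < n) a k *: F k = 0 -> forall k, (k < n)%N -> a k = 0.
Proof.
move=> sF; elim: n => // n IH; rewrite big_ord_recr /= => sum0.
have an0 : a n = 0.
  move/(congr1 (fun p : {poly R} => p`_n)): (sum0).
  rewrite coefD coef_sum big1 => [|k _]; last first.
    by rewrite coefZ nth_default ?mulr0// sF.
  rewrite add0r coefZ coef0 => /eqP; rewrite mulf_eq0 => /orP[/eqP //|].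
  have : lead_coef (F n) != 0 by rewrite lead_coef_eq0 -size_poly_eq0 sF.
  by rewrite lead_coefE sF => /negbTE ->.
move: sum0; rewrite an0 scale0r addr0 => /IH a0 k.
by rewrite ltnS leq_eqVlt => /orP[/eqP -> //|/a0].
Qed.

Lemma act_inj d e X Y (F : nat -> {poly R}) :
  (forall k, size (F k) = k.+1) -> upper_band d X -> upper_band e Y ->
  infmx_act X F = infmx_act Y F -> X = Y.
Proof.
move=> sF bX bY XY; apply/funext => i; apply/funext => j.
(* Long enough for row [i] of both matrices and for column [j]. *)
set n := (maxn (i + maxn d e) j).+1.
have dn : (i + d < n)%N by rewrite ltnS leq_max leq_add2l leq_maxl.
have en : (i + e < n)%N by rewrite ltnS leq_max leq_add2l leq_maxr.
apply/eqP; rewrite -subr_eq0; apply/eqP.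
apply: (simple_sequence_free (a := fun k => X i k - Y i k) (n := n) sF).
  under eq_bigr => k _ do rewrite scalerBl.
  by rewrite sumrB -(infmx_actE F bX dn) -(infmx_actE F bY en) XY subrr.
by rewrite ltnS leq_maxr.
Qed.

(** * The four matrices of the transformation *)

Lemma upper_band_J (D C : nat -> R) : upper_band 1 (J_mon D C).
Proof.
move=> i k; rewrite addn1 /J_mon => ltk.
rewrite (gtn_eqF ltk) (gtn_eqF (ltnW ltk)).
by rewrite (ltn_eqF (leq_trans (ltnW ltk) (leqnSn k))).
Qed.

Lemma upper_band_Js N (c : nat -> nat -> R) : upper_band N (Js_mon N c).
Proof. by move=> i k; rewrite /Js_mon ltnNge => /negbTE ->; rewrite andbF. Qed.

Lemma upper_band_L N (A : nat -> nat -> R) : upper_band 0 (L_mon N A).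
Proof.
move=> i k; rewrite addn0 /L_mon => ltk.
by rewrite (gtn_eqF ltk) [(k < i)%N]ltnNge (ltnW ltk) andbF.
Qed.

Lemma upper_band_U N (B : nat -> nat -> R) : upper_band N (U_mon N B).
Proof. by move=> i k; rewrite /U_mon ltnNge => /negbTE ->; rewrite andbF. Qed.

Lemma act_J P (D C : nat -> R) :
  jacobi_coefs P D C -> infmx_act (J_mon D C) P = fun i => 'X * P i.
Proof.
move=> JP; apply/funext => i; rewrite JP (infmx_actE _ (upper_band_J D C) (ltnSn _)).
rewrite addn1 !big_ord_recr /= /J_mon eqxx (ltn_eqF (ltnSn i)) eqxx scale1r.
rewrite [RHS]addrC [in RHS](addrC _ (D i *: P i)) [RHS]addrA; congr (_ + _ + _).
case: i => [|i]; first by rewrite big_ord0 scaler0.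
rewrite big_ord_recr /= (ltn_eqF (ltnW (ltnSn i.+1))) (ltn_eqF (ltnSn i)) eqxx.
rewrite big1 ?add0r// => k _.
have ki := ltn_ord k.
by rewrite eqSS (gtn_eqF ki) (ltn_eqF (leqW (leqW ki))) (ltn_eqF (leqW ki)) scale0r.
Qed.

(** The recurrences sum over a window of indices, whereas the action of a band
    matrix sums over an initial segment, with zero entries outside the window. *)
Lemma sum_band V (a : nat -> R) (F : nat -> V) m n :
  \sum_(m <= k < n) a k *: F k =
  \sum_(k < n) (if (m <= k < n)%N then a k else 0) *: F k.
Proof.
rewrite (big_nat_widenl m 0)//= big_mkord big_mkcond; apply: eq_bigr => k _ /=.
by rewrite ltn_ord andbT; case: leqP; rewrite ?scale0r.
Qed.

Lemma act_Js N h Ps (c : nat -> nat -> R) :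
  recurrence_coefs N h Ps c -> infmx_act (Js_mon N c) Ps = fun i => h * Ps i.
Proof.
move=> cP; apply/funext => i; have [-> _] := cP i.
by rewrite (infmx_actE _ (upper_band_Js (N := N) c) (ltnSn _)) sum_band.
Qed.

Lemma act_U N h P Ps (B : nat -> nat -> R) :
  upper_coefs N h P Ps B -> infmx_act (U_mon N B) Ps = fun i => h * P i.
Proof.
move=> BP; apply/funext => i; have [-> _ _] := BP i.
by rewrite (infmx_actE _ (upper_band_U (N := N) B) (ltnSn _)) sum_band.
Qed.

Lemma act_L N P Ps (A : nat -> nat -> R) :
  lower_coefs N P Ps A -> infmx_act (L_mon N A) P = Ps.
Proof.
move=> AP; apply/funext => i; rewrite AP (infmx_actE _ (upper_band_L N A) (ltnSn _)).
rewrite addn0 big_ord_recr /= /L_mon eqxx scale1r addrC sum_band.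
by congr (_ + _); apply: eq_bigr => k _; rewrite (ltn_eqF (ltn_ord k)).
Qed.

End InfiniteMatrices.

Theorem proposition6 (R : realType) (N : nat) (h : {poly R})
    (I : interval R) (mu0 : {measure set (measurableTypeR R) -> \bar R})
    (formh : {biscalar {poly R}})
    (P Ps : nat -> {poly R})
    (D C : nat -> R) (c A B : nat -> nat -> R) :
  h \is monic -> size h = N.+1 ->
  (forall f : {poly R}, mu0.-integrable [set` I] (fun x => (f.[x])%:E)) ->
  positive_definite (integral_form mu0 I) ->
  (forall f g, formh f g = formh g f) ->
  positive_definite formh ->
  (forall f g, formh (h * f) g = integral_form mu0 I f g /\
               formh f (h * g) = integral_form mu0 I f g) ->
  monic_orthogonal (integral_form mu0 I) P ->
  monic_orthogonal formh Ps ->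
  jacobi_coefs P D C ->
  recurrence_coefs N h Ps c ->
  lower_coefs N P Ps A ->
  upper_coefs N h P Ps B ->
  infmx_horner N h (J_mon D C) = infmx_mul (U_mon N B) (L_mon N A) /\
  Js_mon N c = infmx_mul (L_mon N A) (U_mon N B).
Proof.
move=> _ sh _ _ _ _ _ [degP _] [degPs _] JP cP AP BP.
have sP n : size (P n) = n.+1 by have [] := degP n.
have sPs n : size (Ps n) = n.+1 by have [] := degPs n.
have bJ := upper_band_J D C; have bJs := upper_band_Js (N := N) c.
have bL := upper_band_L N A; have bU := upper_band_U (N := N) B.
split.
- apply: (act_inj sP (upper_band_horner h bJ) (upper_band_mul bU bL)).
  by rewrite (act_mul _ bU bL) (act_L AP) (act_U BP) (act_horner sh bJ (act_J JP)).
- apply: (act_inj sPs bJs (upper_band_mul bL bU)).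
  rewrite (act_mul _ bL bU) (act_U BP) (act_mulpoly _ _ bL) (act_L AP).
  exact: act_Js.
Qed.
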